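(* Let $X$ be a Banach space with the property that for any countable sequence of functionals $(f_n)_{n<\omega}\subset X^*$ there exists a generating family of vectors $\{x_\gamma\}_{\gamma\in\Gamma}\subset X$ such that $|\{\gamma\in\Gamma: f_n(x_\gamma)\neq0\}|\le\aleph_0$ for all $n<\omega$. Then the coseparable subspaces of $X$ are stable under countable intersections: if $(Y_n)_{n<\omega}$ are coseparable closed subspaces of $X$, then $\bigcap_{n<\omega}Y_n$ is coseparable. In particular, this is the case if $X$ is weakly Lindelöf determined (WLD).
   Context: Banach spaces are real and infinite-dimensional. A family is generating if its closed linear span is $X$. A closed subspace $Y\subset X$ is coseparable if $X/Y$ is separable. A compact Hausdorff space is Corson compact if it embeds in a $\Sigma$-product of real lines (the subspace of some $\mathbb R^\Gamma$ consisting of countably supported elements); $X$ is WLD if the closed unit ball of $X^*$ in the weak-star topology is Corson compact. *)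

(* Defs.v *)
From HB Require Import structures.
From mathcomp Require Import all_boot all_order all_algebra.
From mathcomp Require Import generic_quotient ring_quotient.
From mathcomp Require Import all_classical all_reals all_analysis.

Set Implicit Arguments.
Unset Strict Implicit.
Unset Printing Implicit Defensive.

Import Order.TTheory GRing.Theory Num.Theory.
Import numFieldNormedType.Exports.

Local Open Scope classical_set_scope.
Local Open Scope ring_scope.

Section Topology.

Definition separable (T : topologicalType) : Prop :=
  exists2 D : set T, countable D & dense D.

Definition embedding (S T : topologicalType) (h : S -> T) : Prop :=
  [/\ injective h, continuous h &
      forall U : set S, open U -> exists2 V : set T, open V & h @` U = V `&` range h].

(* As a type, this set carries the subspace topology of the product topology. *)
Definition Sigma_product (R : realType) (Gamma : Type) : set {ptws Gamma -> R} :=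
  [set g | countable [set i | g i != 0]].

Arguments Sigma_product R Gamma : clear implicits.

Definition Corson_compact (R : realType) (K : topologicalType) : Prop :=
  [/\ compact [set: K], hausdorff_space K &
      exists (Gamma : Type) (h : K -> Sigma_product R Gamma), embedding h].

End Topology.

Section Spans.
Context (R : realType) (X : normedModType R).

Definition lin_span (A : set X) : set X :=
  [set x | exists (n : nat) (a : 'I_n -> R) (v : 'I_n -> X),
     (forall i, A (v i)) /\ x = \sum_i a i *: v i].

Definition infinite_dimensional : Prop :=
  forall A : set X, finite_set A -> lin_span A <> setT.

Definition generating (Gamma : Type) (x : Gamma -> X) : Prop :=
  closure (lin_span (range x)) = setT.

End Spans.

Section Dual.
Context (R : realType) (X : normedModType R).

(* As a type, [dual] carries the topology of pointwise convergence on X,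
   that is, the weak-star topology; so does [dual_ball]. *)
Definition dual : set {ptws X -> R} :=
  [set f | linear (f : X -> R^o) /\ continuous (f : X -> R)].

Definition dual_norm (f : dual) : R :=
  sup [set `|\val f x| | x in [set x : X | `|x| <= 1]].

Definition dual_ball : set dual := [set f | dual_norm f <= 1].

Definition WLD : Prop := Corson_compact R dual_ball.

End Dual.

Arguments dual {R} X.
Arguments dual_ball {R} X.
Arguments WLD {R} X.

Record closed_subspace (R : realType) (X : normedModType R) := ClosedSubspace {
  subspace_set :> set X;
  subspace0 : subspace_set 0;
  subspace_lin : forall (a : R) (x y : X),
    subspace_set x -> subspace_set y -> subspace_set (a *: x + y);
  subspace_closed : closed subspace_set }.

Definition subspace_pred (R : realType) (X : normedModType R)
  (Y : closed_subspace X) : {pred X} := fun x => x \in (Y : set X).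

Section Quotient.
Context (R : realType) (X : normedModType R) (Y : closed_subspace X).
Local Open Scope quotient_scope.

Let subspace_submod : submod_closed (subspace_pred Y).
Proof.
split; first by apply/mem_set/subspace0.
by move=> a x y /set_mem Yx /set_mem Yy; apply/mem_set/subspace_lin.
Qed.

HB.instance Definition _ :=
  GRing.isSubmodClosed.Build R X (subspace_pred Y) subspace_submod.

Definition quot : Type := ring_quotient.Quotient.quot (subspace_pred Y).

HB.instance Definition _ := GRing.Zmodule.on quot.
HB.instance Definition _ := EqQuotient.on quot.

Definition coset (x : X) : quot := \pi_quot x.

Lemma cosetK (q : quot) : coset (repr q) = q. Proof. exact: reprK. Qed.

Lemma coset_eqP (x y : X) : coset x = coset y <-> (Y : set X) (x - y).
Proof.
have E : ((x - y) \in subspace_pred Y) = (coset x == coset y).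
  exact: ring_quotient.Quotient.idealrBE.
split; first by move/eqP; rewrite -E => /set_mem.
by move=> /mem_set H; apply/eqP; rewrite -E.
Qed.

Lemma cosetD (x y : X) : coset (x + y) = coset x + coset y.
Proof. by rewrite /coset [LHS]ring_quotient.Quotient.pi_add. Qed.

Lemma coset0 : coset 0 = 0.
Proof. by apply: (addIr (coset 0)); rewrite -cosetD !add0r. Qed.

Definition quot_scale (a : R) (q : quot) : quot := coset (a *: repr q).

Lemma cosetZ (a : R) (x : X) : coset (a *: x) = quot_scale a (coset x).
Proof.
apply/coset_eqP; rewrite -scalerBr -[_ *: _]addr0.
apply: subspace_lin; last exact: subspace0.
by apply/coset_eqP; rewrite cosetK.
Qed.

Let scaleA a b q : quot_scale a (quot_scale b q) = quot_scale (a * b) q.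
Proof. by rewrite -(cosetK q) -!cosetZ scalerA. Qed.

Let scale1 : left_id 1 quot_scale.
Proof. by move=> q; rewrite -(cosetK q) -cosetZ scale1r. Qed.

Let scaleDr : right_distributive quot_scale +%R.
Proof.
by move=> a p q; rewrite -(cosetK p) -(cosetK q) -cosetD -!cosetZ scalerDr cosetD.
Qed.

Let scaleDl q : {morph quot_scale^~ q : a b / a + b}.
Proof. by move=> a b /=; rewrite -(cosetK q) -!cosetZ scalerDl cosetD. Qed.

HB.instance Definition _ :=
  GRing.Zmodule_isLmodule.Build R quot scaleA scale1 scaleDr scaleDl.

Definition quot_norm (q : quot) : R := inf [set `|x| | x in [set x | coset x = q]].

Let norm_has_inf (q : quot) : has_inf [set `|x| | x in [set x | coset x = q]].
Proof.
split; first by exists `|repr q|, (repr q) => //=; exact: cosetK.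
by exists 0 => _ [x _ <-].
Qed.

Lemma quot_norm_le (x : X) : quot_norm (coset x) <= `|x|.
Proof. by apply: ge_inf; [case: (norm_has_inf (coset x)) | exists x]. Qed.

Lemma quot_norm_lt (q : quot) (e : R) : quot_norm q < e ->
  exists2 x, coset x = q & `|x| < e.
Proof.
by move=> qe; have [_ [x <- <-] xe] := inf_lt (proj1 (norm_has_inf q)) qe; exists x.
Qed.

Lemma quot_norm_ge0 (q : quot) : 0 <= quot_norm q.
Proof.
apply: lb_le_inf; first by case: (norm_has_inf q).
by move=> _ [x _ <-].
Qed.

Let normD p q : quot_norm (p + q) <= quot_norm p + quot_norm q.
Proof.
apply/ler_addgt0Pr => e e0.
have e2 : 0 < e / 2 by rewrite divr_gt0.
have [x xp xe] : exists2 x, coset x = p & `|x| < quot_norm p + e / 2.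
  by apply: quot_norm_lt; rewrite ltrDl.
have [y yq ye] : exists2 y, coset y = q & `|y| < quot_norm q + e / 2.
  by apply: quot_norm_lt; rewrite ltrDl.
rewrite -{1}xp -{1}yq -cosetD (le_trans (quot_norm_le _))//.
rewrite (le_trans (ler_normD _ _))// [e in leRHS]splitr addrACA.
by rewrite lerD// ltW.
Qed.

Let normZ_le a q : quot_norm (a *: q) <= `|a| * quot_norm q.
Proof.
have [->|a0] := eqVneq a 0.
  by rewrite scale0r normr0 mul0r -coset0 (le_trans (quot_norm_le _))// normr0.
rewrite -ler_pdivrMl ?normr_gt0//.
apply: lb_le_inf; first by case: (norm_has_inf q).
move=> _ [x /= <- <-]; rewrite ler_pdivrMl ?normr_gt0// -normrZ.
have <- : coset (a *: x) = a *: coset x by exact: cosetZ.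
exact: quot_norm_le.
Qed.

Let normZ a q : quot_norm (a *: q) = `|a| * quot_norm q.
Proof.
apply/eqP; rewrite eq_le normZ_le /=.
have [->|a0] := eqVneq a 0; first by rewrite normr0 mul0r quot_norm_ge0.
have := normZ_le a^-1 (a *: q).
by rewrite scalerA mulVf// scale1r normfV ler_pdivlMl ?normr_gt0.
Qed.

Let norm0_eq0 q : quot_norm q = 0 -> q = 0.
Proof.
move=> q0; rewrite -(cosetK q) -coset0; apply/coset_eqP; rewrite subr0.
apply: subspace_closed => U /nbhs_ballP [e /= e0 eU].
have [x xq xe] : exists2 x, coset x = q & `|x| < e.
  by apply: quot_norm_lt; rewrite q0.
exists (repr q - x); split; first by apply/coset_eqP; rewrite cosetK xq.
by apply: eU; rewrite -ball_normE /ball_ /= opprB addrC subrK.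
Qed.

HB.instance Definition _ :=
  Lmodule_isNormed.Build R quot normD normZ norm0_eq0.

End Quotient.

Definition coseparable (R : realType) (X : normedModType R)
  (Y : closed_subspace X) : Prop := separable (quot Y).

Section Intersection.
Context (R : realType) (X : normedModType R) (Y : nat -> closed_subspace X).

Let bigcap_set : set X := \bigcap_n Y n.

Let bigcap0 : bigcap_set 0.
Proof. by move=> n _; exact: subspace0. Qed.

Let bigcap_lin (a : R) (x y : X) :
  bigcap_set x -> bigcap_set y -> bigcap_set (a *: x + y).
Proof. by move=> Yx Yy n _; apply: subspace_lin; [exact: Yx|exact: Yy]. Qed.

Let bigcap_closed : closed bigcap_set.
Proof. by apply: closed_bigI => n _; exact: subspace_closed. Qed.

Definition bigcap_subspace : closed_subspace X :=
  ClosedSubspace bigcap0 bigcap_lin bigcap_closed.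

End Intersection.

(* Main.v *)
From HB Require Import structures.
Require Import Defs.
From mathcomp Require Import all_boot all_order all_algebra.
From mathcomp Require Import all_classical all_reals all_analysis.
From mathcomp Require Import ring lra.
Import Order.TTheory GRing.Theory Num.Theory.
Import numFieldNormedType.Exports.
Local Open Scope classical_set_scope.
Local Open Scope ring_scope.

(* A coseparable Y is the common kernel of countably many functionals, because
   the dual of the separable space X/Y is weak-star separable.  Applying the
   hypothesis to all these functionals for all Y n, only countably many vectors
   of the generating family lie outside the intersection Z, and their images
   generate X/Z.

   If K, the unit ball of the dual, is Corson compact, the hypothesis holds.
   Given functionals f n, a closing-off argument produces a countable set A of
   coordinates, a countable E in X and a countable D in K containing multiples
   of the f n, such that L := closure D is convex, symmetric and supported in A,
   the coordinates in A and the evaluations at E determine each other on K, and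
   every k in K agrees on A, hence on E, with some l in L.  So the supremum q
   over L equals the norm on span E.  If g is linear, below the q-distance to
   span E, then g is in L by the bipolar theorem and vanishes on E, so g = 0; by
   Hahn-Banach that distance vanishes.  Completeness then gives
   X = closure (span E) + (annihilator of L), so E together with the common
   kernel of the f n is generating. *)

(** * Sublinear functionals and the Hahn-Banach theorem *)

Definition sublinear {R : realType} {V : lmodType R} (p : V -> R) : Prop :=
  (forall x y, p (x + y) <= p x + p y) /\
  (forall t x, 0 <= t -> p (t *: x) <= t * p x).

Lemma sublinear0 {R : realType} {V : lmodType R} {p : V -> R} :
  sublinear p -> p 0 = 0.
Proof.
move=> [pD pZ]; apply/eqP; rewrite eq_le; apply/andP; split.
  by have := pZ 0 0 (lexx _); rewrite scale0r mul0r.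
by have := pD 0 0; rewrite addr0; lra.
Qed.

Lemma sublinearN {R : realType} {V : lmodType R} {p : V -> R} (x : V) :
  sublinear p -> - p (- x) <= p x.
Proof.
by move=> sp; have := sp.1 x (- x); rewrite subrr (sublinear0 sp); lra.
Qed.

Lemma sublinearZ {R : realType} {V : lmodType R} {p : V -> R} (t : R) (x : V) :
  sublinear p -> 0 <= t -> p (t *: x) = t * p x.
Proof.
move=> sp; rewrite le_eqVlt => /predU1P[<-|t0].
  by rewrite scale0r mul0r (sublinear0 sp).
apply/eqP; rewrite eq_le (sp.2 _ _ (ltW t0))/= -ler_pdivlMl//.
have ti : 0 <= t^-1 by rewrite invr_ge0 ltW.
by have := sp.2 _ (t *: x) ti; rewrite scalerA mulVf ?scale1r ?gt_eqF.
Qed.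

(** Take [q x] to be the infimum of [p (x + t *: y) - t * p y] over [t >= 0]. It is finite, being at
    least [- p (- x)]; [t = 0] bounds it by [p x], and [t = 1] gives the value at [- y]. *)
Lemma sublinear_tilt {R : realType} {V : lmodType R} {p : V -> R} (y : V) :
  sublinear p -> exists q, [/\ sublinear q, forall x, q x <= p x & q (- y) <= - p y].
Proof.
move=> sp.
pose S x := [set r | exists2 t : R, 0 <= t & r = p (x + t *: y) - t * p y].
have lbS x : lbound (S x) (- p (- x)).
  move=> _ [t t0 ->]; have := sp.1 (x + t *: y) (- x).
  by rewrite addrAC subrr add0r (sublinearZ _ _ sp t0); lra.
have iS x t : 0 <= t -> inf (S x) <= p (x + t *: y) - t * p y.
  by move=> t0; apply: ge_inf; [exists (- p (- x)); exact: lbS|exists t].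
have S0 x : S x !=set0 by exists (p (x + 0 *: y) - 0 * p y), 0.
exists (fun x => inf (S x)); split; first split.
- move=> x x' /=; rewrite -lerBlDr; apply: lb_le_inf => // _ [t t0 ->].
  rewrite lerBlDr -lerBlDl; apply: lb_le_inf => // _ [t' t'0 ->].
  rewrite lerBlDl (le_trans (iS _ (t + t') _)) ?addr_ge0// scalerDl addrACA.
  by have := sp.1 (x + t *: y) (x' + t' *: y); lra.
- move=> s x /=; rewrite le_eqVlt => /predU1P[<-|s0].
    rewrite scale0r mul0r (le_trans (iS _ 0 _))//.
    by rewrite scale0r addr0 (sublinear0 sp); lra.
  rewrite -ler_pdivrMl//; apply: lb_le_inf => // _ [t t0 ->].
  rewrite ler_pdivrMl// (le_trans (iS _ _ (mulr_ge0 (ltW s0) t0)))//.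
  by rewrite -scalerA -scalerDr (sublinearZ _ _ sp (ltW s0)) mulrBr mulrA.
- by move=> x; rewrite (le_trans (iS _ 0 _))// scale0r addr0 mul0r subr0.
- rewrite (le_trans (iS _ 1 ler01))// scale1r addNr (sublinear0 sp).
  by rewrite mul1r sub0r.
Qed.

Lemma minimal_sublinear {R : realType} {V : lmodType R} {p : V -> R} :
  sublinear p ->
  exists m, [/\ sublinear m, forall x, m x <= p x &
    forall q, sublinear q -> (forall x, q x <= m x) -> q = m].
Proof.
move=> sp.
pose T := {m : V -> R | sublinear m /\ forall x, m x <= p x}.
(* The order is reversed, so that a maximal element for Zorn is a pointwise minimal functional. *)
pose ge (u v : T) := `[< forall x, sval v x <= sval u x >].
have [|u v w /asboolP uv /asboolP vw|u v /asboolP uv /asboolP vu|A Atot|m mmin] :=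
    @Zorn T ge.
- by move=> u; apply/asboolP.
- by apply/asboolP => x; exact: le_trans (vw x) (uv x).
- case: u v uv vu => [u pu] [v pv] /= uv vu.
  by apply: eq_exist; apply/funext => x; apply/eqP; rewrite eq_le uv vu.
(* The empty chain is bounded by [p] itself, any other chain by its pointwise infimum. *)
- have [[u0 Au0]|A0] := pselect (exists u, A u); last first.
    by exists (exist _ p (conj sp (fun=> lexx _))) => u Au; case: A0; exists u.
  pose S x := [set sval u x | u in A].
  have lbS x : lbound (S x) (- p (- x)).
    move=> _ [u Au <-]; have [su up] := svalP u.
    by rewrite (le_trans _ (sublinearN _ su))// lerN2.
  have S0 x : S x !=set0 by exists (sval u0 x), u0.
  have iS x u : A u -> inf (S x) <= sval u x.
    by move=> Au; apply: ge_inf; [exists (- p (- x)); exact: lbS|exists u].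
  have sm : sublinear (fun x => inf (S x)).
    split=> [x y|t x] /=.
      rewrite -lerBlDr; apply: lb_le_inf => // _ [u Au <-].
      rewrite lerBlDr -lerBlDl; apply: lb_le_inf => // _ [v Av <-].
      (* Subadditivity survives the infimum because [u] and [v] are comparable: apply that of the
         smaller one. *)
      rewrite lerBlDl; have [/asboolP uv|/asboolP vu] := Atot _ _ Au Av.
        have := (svalP v).1.1 x y; have := iS (x + y) v Av; have := uv x; lra.
      have := (svalP u).1.1 x y; have := iS (x + y) u Au; have := vu y; lra.
    rewrite le_eqVlt => /predU1P[<-|t0].
      rewrite scale0r mul0r (le_trans (iS _ u0 Au0))//.
      by rewrite (sublinear0 (svalP u0).1).
    rewrite -ler_pdivrMl//; apply: lb_le_inf => // _ [u Au <-].
    rewrite ler_pdivrMl// (le_trans (iS _ u Au))//.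
    by rewrite (svalP u).1.2// ltW.
  have mp x : inf (S x) <= p x by rewrite (le_trans (iS x u0 Au0))// (svalP u0).2.
  by exists (exist _ (fun x => inf (S x)) (conj sm mp)) => u Au; apply/asboolP => x; exact: iS.
- exists (sval m); split; [exact: (svalP m).1|exact: (svalP m).2|].
  move=> q sq qm.
  have qp x : q x <= p x by exact: le_trans (qm x) ((svalP m).2 x).
  by rewrite -(mmin (exist _ q (conj sq qp)))//; apply/asboolP.
Qed.

(* A minimal sublinear functional absorbs all its tilts, hence is odd, hence
   linear; starting from the tilt of p at x0 forces the value at x0. *)
Lemma hahn_banach {R : realType} {V : lmodType R} (p : V -> R) (x0 : V) :
  sublinear p ->
  exists f : V -> R, [/\ linear (f : V -> R^o), forall x, f x <= p x & f x0 = p x0].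
Proof.
move=> sp; have [q [sq qp qx0]] := sublinear_tilt x0 sp.
have [m [sm mq mmin]] := minimal_sublinear sq.
have mN y : m (- y) = - m y.
  have [r [sr rm ry]] := sublinear_tilt y sm.
  rewrite (mmin r sr rm) in ry.
  by have := sublinearN y sm; lra.
have mD x y : m (x + y) = m x + m y.
  have := sm.1 x y; have := sm.1 (- x) (- y).
  by rewrite -opprD !mN; lra.
have mZ a u : m (a *: u) = a * m u.
  have [a0|a0] := leP 0 a; first exact: sublinearZ.
  by rewrite -[a]opprK scaleNr mN (sublinearZ _ _ sm) ?mulNr// oppr_ge0 ltW.
exists m; split.
- by move=> a u v; rewrite mD mZ.
- by move=> x; exact: le_trans (mq x) (qp x).
- have := mq x0; have := mq (- x0); have := qp x0; rewrite mN; lra.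
Qed.

(** * The dual unit ball in the weak-star topology *)

Definition ev {R : realType} {X : normedModType R} (k : dual_ball X) (x : X) : R :=
  \val (\val k) x.

Section DualBall.
Context {R : realType} {X : normedModType R}.
Implicit Types (k l : dual_ball X) (f : dual X) (x y : X) (a : R).

Lemma dualP f : linear (\val f : X -> R^o) /\ continuous (\val f : X -> R).
Proof. exact: set_mem (valP f). Qed.

Lemma dual_linear f a x y : \val f (a *: x + y) = a * \val f x + \val f y.
Proof. exact: (dualP f).1. Qed.

Lemma dual0 f : \val f 0 = 0.
Proof. by have := dual_linear f 1 0 0; rewrite scale1r addr0; lra. Qed.

Lemma dual_bounded f : exists2 M, 0 < M & forall x, `|\val f x| <= M * `|x|.
Proof.
pose g := GRing.isLinear.Build R X R^o *:%R (\val f) (dualP f).1.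
pose F : {linear X -> R^o} := HB.pack (\val f : X -> R^o) g.
have /linear_boundedP[M [Mreal MF]] : bounded_near F (nbhs 0).
  by apply/continuous_linear_bounded; exact: (dualP f).2.
(* The bound holds for every constant above [M]; this one is also positive. *)
exists (`|M| + 1); first by rewrite ltr_wpDl.
by move=> x; apply: (MF (`|M| + 1)); rewrite (le_lt_trans (ler_norm _))// ltrDl.
Qed.

Lemma has_sup_dual_norm f : has_sup [set `|\val f x| | x in [set x : X | `|x| <= 1]].
Proof.
have [M M0 fM] := dual_bounded f.
split; first by exists `|\val f 0|, 0 => //=; rewrite normr0.
exists M => _ [x /= x1 <-]; rewrite (le_trans (fM x))//.
by rewrite -[leRHS]mulr1 ler_pM2l.
Qed.

Lemma dual_ballP f : dual_ball X f <-> forall x, `|\val f x| <= `|x|.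
Proof.
split=> [fB x|fB]; last first.
  apply: ge_sup; first by case: (has_sup_dual_norm f).
  by move=> _ [x /= x1 <-]; rewrite (le_trans (fB x)).
have fZ a : \val f (a *: x) = a * \val f x.
  by rewrite -[a *: x]addr0 dual_linear dual0 addr0.
have [->|x0] := eqVneq x 0.
  by rewrite dual0 !normr0.
rewrite -[leRHS]mulr1 -ler_pdivrMl ?normr_gt0//.
have -> : `|x|^-1 * `|\val f x| = `|\val f (`|x|^-1 *: x)|.
  by rewrite fZ normrM normfV normr_id.
rewrite (le_trans _ fB)//; apply: ub_le_sup; first by case: (has_sup_dual_norm f).
by exists (`|x|^-1 *: x) => //=; rewrite normrZ normfV normr_id mulVf ?normr_eq0.
Qed.

Lemma ev_linear k a x y : ev k (a *: x + y) = a * ev k x + ev k y.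
Proof. exact: dual_linear. Qed.

Lemma ev0 k : ev k 0 = 0.
Proof. exact: dual0. Qed.

Lemma evD k x y : ev k (x + y) = ev k x + ev k y.
Proof. by rewrite -[x]scale1r ev_linear mul1r scale1r. Qed.

Lemma evZ k a x : ev k (a *: x) = a * ev k x.
Proof. by rewrite -[a *: x]addr0 ev_linear ev0 addr0. Qed.

Lemma evN k x : ev k (- x) = - ev k x.
Proof. by rewrite -scaleN1r evZ mulN1r. Qed.

Lemma ev_le k x : `|ev k x| <= `|x|.
Proof. by move: x; apply/dual_ballP; exact: set_mem (valP k). Qed.

Lemma ev_inj k l : (forall x, ev k x = ev l x) -> k = l.
Proof. by move=> kl; apply/val_inj/val_inj/funext. Qed.

(** The one-sided bound becomes two-sided by applying it to [- x]. This turns functionals dominated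
    by the norm, such as those from [hahn_banach], into points of the ball. *)
Lemma dual_ball_of (f : X -> R) :
  linear (f : X -> R^o) -> (forall x, f x <= `|x|) -> exists k, ev k = f.
Proof.
move=> fl fle.
pose g := GRing.isLinear.Build R X R^o *:%R f fl.
pose F : {linear X -> R^o} := HB.pack (f : X -> R^o) g.
have fB x : `|f x| <= `|x|.
  rewrite ler_norml fle andbT lerNl -[- f x](raddfN F).
  by rewrite (le_trans (fle _))// normrN.
have fc : continuous (f : X -> R).
  apply: (@linear_bounded_continuous _ _ _ F).1.
  apply/linear_boundedP; exists 1; split=> // M M1 x.
  by rewrite (le_trans (fB x))// ler_peMl// ltW.
pose f' : dual X := SigSub (mem_set (conj fl fc) : (f : {ptws X -> R}) \in dual X).
have fB' : dual_ball X f' by apply/dual_ballP.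
by exists (SigSub (mem_set fB') : dual_ball X).
Qed.

Lemma dual_ball_scale f : exists2 c, 0 < c & exists k, ev k = (fun x => c * \val f x).
Proof.
have [M M0 fM] := dual_bounded f; exists M^-1; first by rewrite invr_gt0.
apply: dual_ball_of => [a x y|x].
  by rewrite dual_linear mulrDr /GRing.scale/= mulrCA.
by rewrite ler_pdivrMl// (le_trans (ler_norm _)).
Qed.

Lemma ev_weak_continuous x : continuous (fun k => ev k x).
Proof.
move=> k; apply: (@continuous_comp _ _ _ (fun k => \val k) (fun f => \val f x)).
  exact: initial_continuous.
apply: (@continuous_comp _ _ _ (fun f : dual X => \val f) (fun g : {ptws X -> R} => g x)).
  exact: initial_continuous.
exact: (@proj_continuous X (fun=> R) x).
Qed.

(** The ball carries the initial topology of its inclusion in the dual, itself initial for pointwise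
    convergence. *)
Lemma dual_ball_continuous (T : topologicalType) (phi : T -> dual_ball X) :
  (forall x, continuous (fun t => ev (phi t) x)) -> continuous phi.
Proof.
move=> cphi; apply: continuous_comp_initial.
apply: continuous_comp_initial => t.
by apply/pointwise_cvgP => x; exact: cphi.
Qed.

End DualBall.

(** * Compactness: solving systems of equations and countable determination *)

Section Compactness.
Context {R : realType} {T : topologicalType}.

(** The approximate solution sets, over finitely many indices and a tolerance, generate a proper
    filter containing [L]. A cluster point in [L] is an exact solution: an error at index [i] would
    contradict tolerance of half that error. *)
Lemma compact_interpolation (I : Type) (L : set T) (psi : I -> T -> R) (c : I -> R) :
  compact L -> (forall i, continuous (psi i)) ->
  (forall (s : seq I) e, 0 < e ->
     exists2 t, L t & all (fun i => `|psi i t - c i| < e) s) ->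
  exists2 t, L t & forall i, psi i t = c i.
Proof.
move=> Lc psic approx.
pose B (s : seq I) (e : R) := [set t | L t /\ all (fun i => `|psi i t - c i| < e) s].
pose F : set_system T := [set A | exists s e, 0 < e /\ B s e `<=` A].
have FF : ProperFilter F.
  split; last split.
  - by move=> [s [e [e0 sub]]]; have [t Lt ts] := approx s e e0; apply: (sub t).
  - by exists [::], 1.
  - move=> P Q [s [e [e0 sP]]] [s' [e' [e'0 sQ]]].
    exists (s ++ s'), (Num.min e e'); split; first by rewrite lt_min e0.
    move=> t [Lt]; rewrite all_cat => /andP[ts ts'].
    split; [apply: sP|apply: sQ]; split=> //.
      by apply: sub_all ts => i; rewrite lt_min => /andP[].
    by apply: sub_all ts' => i; rewrite lt_min => /andP[].
  - by move=> P Q PQ [s [e [e0 sP]]]; exists s, e; split=> // t /sP /PQ.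
have FL : F L by exists [::], 1; split=> // t [].
have [t [Lt tF]] := Lc F FF FL.
exists t => // i; apply/eqP; rewrite -subr_eq0 -normr_le0 leNgt; apply/negP => d0.
have d2 : 0 < `|psi i t - c i| / 2 by rewrite divr_gt0.
have /tF : F (B [:: i] (`|psi i t - c i| / 2)) by exists [:: i], (`|psi i t - c i| / 2); split.
have /cvgrPdist_lt/(_ _ d2) nt := psic i t.
move=> /(_ _ nt) [u [[_ /=]]]; rewrite andbT => ui tu.
have := ler_distD (psi i u) (psi i t) (c i); lra.
Qed.

Lemma compact_argmin (L : set T) (psi : T -> R) :
  compact L -> L !=set0 -> continuous psi -> (forall t, 0 <= psi t) ->
  exists2 t, L t & forall u, L u -> psi t <= psi u.
Proof.
move=> Lc [t0 Lt0] psic psi0.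
have iP : has_inf [set psi t | t in L].
  by split; [exists (psi t0), t0|exists 0 => _ [t _ <-]].
(* Attaining the infimum is a system with one equation, approximately solvable by definition of the
   infimum. *)
have [//||t Lt /(_ tt) tE] := @compact_interpolation unit L (fun=> psi)
  (fun=> inf [set psi t | t in L]) Lc.
- move=> s e e0; have [_ [t Lt <-] te] := inf_adherent e0 iP.
  exists t => //; apply/allP => -[] _.
  rewrite ger0_norm ?subr_ge0 ?ltrBlDl//; apply: ge_inf; [exact: iP.2|by exists t].
exists t => // u Lu; rewrite tE; apply: ge_inf; [exact: iP.2|by exists u].
Qed.

End Compactness.

(* [|psi t - psi u| >= 1/(n+1)] defines a compact subset of T x T, on which
   finitely many phi i already separate t from u. *)
Lemma countably_determined {R : realType} {T : topologicalType} (I : Type)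
    (psi : T -> R) (phi : I -> T -> R) :
  compact [set: T] -> continuous psi -> (forall i, continuous (phi i)) ->
  (forall t u, (forall i, phi i t = phi i u) -> t = u) ->
  exists2 J : set I, countable J &
    forall t u, (forall i, J i -> phi i t = phi i u) -> psi t = psi u.
Proof.
move=> Tc psic phic phisep.
pose M n : set (T * T) := [set z | n.+1%:R^-1 <= `|psi z.1 - psi z.2|].
have dc (f : T -> R) : continuous f -> continuous (fun z : T * T => f z.1 - f z.2).
  move=> cf z; apply: cvgB.
    by apply: (@continuous_comp _ _ _ fst f); [exact: cvg_fst|exact: cf].
  by apply: (@continuous_comp _ _ _ snd f); [exact: cvg_snd|exact: cf].
have Mc n : compact (M n).
  apply: (@subclosed_compact _ _ ([set: T] `*` [set: T])) => //.
    apply: (@closed_comp _ _ (fun z : T * T => `|psi z.1 - psi z.2|) [set r | n.+1%:R^-1 <= r]).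
      by move=> z _; apply: cvg_norm; exact: dc.
    exact: closed_ge.
  exact: compact_setX.
(* Membership in a finite sequence of indices requires a choice structure on [I]. *)
elim/Pchoice: I => I in phi phic phisep *.
have /choice[s sP] n : exists s : seq I, forall z, M n z ->
    ~~ all (fun i => phi i z.1 == phi i z.2) s.
  apply: contrapT => /forallNP nP.
  have [i|s e e0|z Mz zE] := @compact_interpolation _ _ I (M n)
    (fun i z => phi i z.1 - phi i z.2) (fun=> 0) (Mc n).
  - exact: dc.
  - have /existsNP[z /not_implyP[Mz /negP/negPn sz]] := nP s.
    by exists z => //; apply: sub_all sz => i /eqP ->; rewrite !subrr normr0.
  - move: Mz; rewrite /M/= (phisep z.1 z.2) => [|i].
      by rewrite subrr normr0 leNgt invr_gt0 ltr0n.
    by apply/eqP; rewrite -subr_eq0; apply/eqP.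
exists (\bigcup_n [set` s n]).
  by apply: bigcup_countable => // n _; apply/finite_set_countable/finite_seq.
move=> t u tu; apply/eqP; rewrite -subr_eq0 -normr_le0 leNgt; apply/negP => d0.
have [n nd] : exists n, n.+1%:R^-1 <= `|psi t - psi u|.
  exists (Num.truncn (`|psi t - psi u|^-1)).
  by rewrite -[leRHS]invrK lef_pV2 ?posrE ?invr_gt0 ?ltr0n// ltW// truncnS_gt.
have /negP := sP n (t, u) nd; apply; apply/allP => i is_.
by apply/eqP/tu; exists n.
Qed.

(** * Countable sets closed under countably-valued finitary operations *)

Lemma countable_range_of {U : Type} (u0 : U) {A : set U} :
  countable A -> exists e : nat -> U, A `<=` range e.
Proof.
move=> /countable_injP [f finj].
(* The default [u0] outside the image of [f] allows [A] to be empty, which is why the conclusion is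
   only an inclusion. *)
pose e n := if pselect (exists2 u, A u & f u = n) is left P then sval (cid2 P) else u0.
exists e => u Au; exists (f u) => //; rewrite /e; case: pselect => [P|[]]; last by exists u.
by apply: finj; rewrite ?inE//; case: (cid2 P).
Qed.

(** Enumerate [S0] and every [Phi s]; then [S] consists of the values of finite trees labelled by
    numbers, and there are only countably many such trees. *)
Lemma countable_closing_off {U : Type} (u0 : U) (Phi : seq U -> set U) (S0 : set U) :
  countable S0 -> (forall s, countable (Phi s)) ->
  exists S, [/\ countable S, S0 `<=` S &
    forall s, all (fun u => `[< S u >]) s -> Phi s `<=` S].
Proof.
move=> /(countable_range_of u0)[e0 S0e] Phic.
have /choice[e Phie] s := countable_range_of u0 (Phic s).
(* Evaluate trees as terms over the operations [e _ n] and the constants [e0 n]. *)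
pose fix eval (t : GenTree.tree nat) : U :=
  match t with
  | GenTree.Leaf n => e0 n
  | GenTree.Node n ts => e (map eval ts) n
  end.
exists (range eval); split.
- exact: sub_countable (card_image_le _ _) _.
- by move=> u /S0e[n _ <-]; exists (GenTree.Leaf n).
- move=> s /= sS u /Phie[n _ <-].
  have [ts <-] : exists ts, map eval ts = s.
    elim: s sS {u n} => [|u s IH] /=; first by exists [::].
    by move=> /andP[/asboolP[t _ <-] /IH[ts <-]]; exists (t :: ts).
  by exists (GenTree.Node n ts).
Qed.

(** * Coseparable subspaces, their annihilators and generating families *)

Section Coseparable.
Context {R : realType} {X : normedModType R}.
Implicit Types (Y Z : closed_subspace X) (x y : X).

Lemma sublinear_coset_norm Y : sublinear (fun x : X => `|coset Y x|).
Proof.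
split=> [x y|t x t0]; first by rewrite cosetD ler_normD.
by rewrite cosetZ [`|_|]normrZ ger0_norm.
Qed.

Lemma coset_norm_le Y x : `|coset Y x| <= `|x|.
Proof. exact: quot_norm_le. Qed.

Lemma coset_eq0 Y x : (Y : set X) x -> coset Y x = 0.
Proof. by move=> Yx; rewrite -coset0; apply/coset_eqP; rewrite subr0. Qed.

(** Let [f k] norm the [k]-th point [e k] of a dense sequence in the quotient. If all [f k] vanish
    at [x], then the norm of [e k] is at most its distance to the coset of [x]; choosing [e k]
    closer than half the norm of that coset is contradictory. *)
Lemma coseparable_annihilator Y : coseparable Y ->
  exists f : nat -> dual X, forall x, (Y : set X) x <-> forall k, \val (f k) x = 0.
Proof.
move=> [D /(countable_range_of 0)[e De] Ddense].
have /choice[f fP] k : exists f : dual X,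
    (forall x, \val f x <= `|coset Y x|) /\ \val f (repr (e k)) = `|e k|.
  have [g [gl gle gk]] := hahn_banach _ (repr (e k)) (sublinear_coset_norm Y).
  have [h hg] := dual_ball_of g gl (fun x => le_trans (gle x) (coset_norm_le Y x)).
  exists (\val h); rewrite -[\val (\val h)]/(ev h) hg; split=> //.
  by rewrite gk cosetK.
exists f => x; split=> [Yx k|fx].
  have Nle : - \val (f k) x <= 0.
    have := (fP k).1 (-1 *: x + 0); rewrite dual_linear dual0 coset_eq0.
      by rewrite normr0; lra.
    by apply: subspace_lin => //; exact: subspace0.
  have := (fP k).1 x; rewrite coset_eq0// normr0; lra.
apply: contrapT => nYx.
have d0 : 0 < `|coset Y x|.
  rewrite normr_gt0; apply/eqP; rewrite -coset0 => /coset_eqP.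
  by rewrite subr0.
have d2 : 0 < `|coset Y x| / 2 by rewrite divr_gt0.
have [q [xk /De[k _ ek]]] : ball (coset Y x) (`|coset Y x| / 2) `&` D !=set0.
  by apply: Ddense; [exists (coset Y x); exact: ballxx|exact: ball_open].
move: xk; rewrite -ek.
rewrite -ball_normE /ball_/= => ck {ek}.
have fkB : \val (f k) (repr (e k)) = \val (f k) (repr (e k) - x).
  rewrite -[repr (e k) - x]addrC -scaleN1r dual_linear fx; lra.
have := (fP k).1 (repr (e k) - x).
rewrite -fkB (fP k).2 -scaleN1r cosetD cosetZ -[quot_scale _ _]/(-1 *: coset Y x).
rewrite scaleN1r cosetK distrC => ek.
have := ler_normD (coset Y x - e k) (e k); rewrite subrK; lra.
Qed.

(** Family members in [Z] have zero coset, so the rational combinations of the countably many others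
    have dense cosets. *)
Lemma generating_coseparable (Gamma : Type) (x : Gamma -> X) Z :
  generating x -> countable [set gamma | ~ (Z : set X) (x gamma)] -> coseparable Z.
Proof.
move=> xgen Zx.
have [u xu] : exists u : nat -> X, x @` [set gamma | ~ (Z : set X) (x gamma)] `<=` range u.
  exact/(countable_range_of 0)/(sub_countable (card_image_le _ _)).
pose comb (s : seq (rat * nat)) : X := \sum_(p <- s) ratr p.1 *: u p.2.
(* Approximability by these combinations modulo [Z]; it is passed from multiples of the family to
   the span, then to its closure. *)
pose P y := forall e : R, 0 < e -> exists s, `|coset Z (y - comb s)| < e.
have P0 : P 0.
  move=> e e0; exists [::].
  by rewrite /comb big_nil subrr coset0 normr0.
have PD y y' : P y -> P y' -> P (y + y').
  move=> Py Py' e e0; have e2 : 0 < e / 2 by rewrite divr_gt0.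
  have [s sy] := Py _ e2; have [s' sy'] := Py' _ e2; exists (s ++ s').
  rewrite /comb big_cat opprD addrACA cosetD (le_lt_trans (ler_normD _ _))//.
  by rewrite [e]splitr ltrD.
have PZ a gamma : P (a *: x gamma).
  move=> e e0; have [Zg|nZg] := pselect ((Z : set X) (x gamma)).
    exists [::]; rewrite /comb big_nil subr0 coset_eq0 ?normr0//.
    by rewrite -[a *: _]addr0; apply: subspace_lin => //; exact: subspace0.
  have [k _ <-] : range u (x gamma) by apply: xu; exists gamma.
  have M0 : 0 < `|u k| + 1 by rewrite ltr_wpDl.
  have a_e : a - e / (`|u k| + 1) < a by rewrite ltrBlDr ltrDl divr_gt0.
  have [q] := rat_in_itvoo a_e; rewrite in_itv/= => /andP[qa aq].
  exists [:: (q, k)]; rewrite /comb big_seq1/= -scalerBl (le_lt_trans (coset_norm_le _ _))//.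
  rewrite normrZ (le_lt_trans (_ : _ <= `|a - ratr q| * (`|u k| + 1)))//.
    by rewrite ler_wpM2l// lerDl.
  rewrite -ltr_pdivlMr// ltr_norml; lra.
have Pspan y : lin_span (range x) y -> P y.
  move=> [n [a [v [vx ->]]]]; apply: big_ind => // i _.
  by have [gamma _ <-] := vx i; exact: PZ.
have PT y : P y.
  move=> e e0; have e2 : 0 < e / 2 by rewrite divr_gt0.
  have : closure (lin_span (range x)) y by rewrite xgen.
  move=> /(_ _ (nbhsx_ballx y _ e2))[w [/Pspan/(_ _ e2)[s ws]]].
  rewrite -ball_normE /ball_/= => yw; exists s.
  rewrite -(subrK w y) -addrA cosetD (le_lt_trans (ler_normD _ _))//.
  by rewrite [e]splitr ltrD// (le_lt_trans (coset_norm_le _ _)).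
exists (range (fun s => coset Z (comb s))).
  exact: sub_countable (card_image_le _ _) _.
move=> O [q Oq] Oo.
have /nbhs_ballP[e /= e0 eO] : nbhs q O by exact: open_nbhs_nbhs.
have [s qs] := PT (repr q) e e0; exists (coset Z (comb s)); split; last by exists s.
apply: eO; rewrite -ball_normE /ball_/=.
by move: qs; rewrite -scaleN1r cosetD cosetZ -[quot_scale _ _]/(-1 *: coset Z (comb s)) scaleN1r cosetK.
Qed.
End Coseparable.

(** * A bipolar theorem for compact sets of functionals *)

Section Bipolar.
Context {R : realType} {X : normedModType R}.
Implicit Types (k l : dual_ball X) (x y : X).

(** A form of convexity that a countable set can satisfy for its own points and that passes to
    closures. *)
Definition midpoint_closed (L : set (dual_ball X)) : Prop :=
  forall k l, L k -> L l -> exists2 m, L m & forall x, ev m x = (ev k x + ev l x) / 2.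

Lemma ev_sum k (s : seq X) (a : X -> R) :
  ev k (\sum_(y <- s) a y *: y) = \sum_(y <- s) a y * ev k y.
Proof.
elim: s => [|y s IH]; first by rewrite !big_nil ev0.
by rewrite !big_cons ev_linear IH.
Qed.

Lemma midpoint_closed_dyadic {L : set (dual_ball X)} {k l} n : midpoint_closed L -> L k -> L l ->
  exists2 m, L m & forall x, ev m x = ev k x + (1 / 2) ^+ n * (ev l x - ev k x).
Proof.
move=> Lmid Lk Ll; elim: n => [|n [m Lm mE]].
  by exists l => // x; rewrite expr0 mul1r addrC subrK.
have [m' Lm' m'E] := Lmid _ _ Lk Lm; exists m' => // x.
by rewrite m'E mE exprS; lra.
Qed.

(** Interpolation reduces the claim to a finite list [s] of vectors. Project [g] onto [L] by
    minimising the sum of squared errors on [s]; testing the hypothesis on the combination of [s]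
    weighted by the negated errors shows that all errors vanish. *)
Lemma compact_midpoint_bipolar (L : set (dual_ball X)) (g : X -> R) :
  compact L -> L !=set0 -> midpoint_closed L -> linear (g : X -> R^o) ->
  (forall y M, (forall l, L l -> ev l y <= M) -> g y <= M) ->
  exists2 l, L l & ev l = g.
Proof.
move=> Lc L0 Lmid gl gL.
suff [l Ll lg] : exists2 l, L l & forall y, ev l y = g y by exists l => //; apply/funext.
apply: (@compact_interpolation _ _ X L (fun y l => ev l y) g Lc ev_weak_continuous).
move=> s e e0.
pose S l : R := \sum_(y <- s) (ev l y - g y) * (ev l y - g y).
have [| |l0 Ll0 l0min] := @compact_argmin _ _ L S Lc L0.
- apply: (continuous_big (@add_continuous R)) => y _ l.
  have cy : {for l, continuous (fun k => ev k y - g y : R)}.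
    exact: (continuousB (@ev_weak_continuous _ _ y l) (@cst_continuous _ _ (g y) l)).
  exact: (continuousM cy cy).
- by move=> l; apply: sumr_ge0 => y _; rewrite -expr2; exact: sqr_ge0.
exists l0 => //.
(* Moving dyadically from the minimiser l0 towards l makes its variation >= 0. *)
pose a y := ev l0 y - g y.
have var l : L l -> 0 <= \sum_(y <- s) a y * (ev l y - ev l0 y).
  move=> Ll; set B := \sum_(y <- s) _.
  pose C := \sum_(y <- s) (ev l y - ev l0 y) ^+ 2.
  have C0 : 0 <= C by apply: sumr_ge0 => y _; exact: sqr_ge0.
  have BC n : 0 <= 2 * B + (1 / 2) ^+ n * C.
    have [m Lm mE] := midpoint_closed_dyadic n Lmid Ll0 Ll.
    set t := (1 / 2) ^+ n in mE *.
    have t0 : 0 < t by rewrite exprn_gt0.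
    have SE : S m = S l0 + t * (2 * B + t * C).
      rewrite /S /B /C !mulr_sumr -!big_split/= mulr_sumr -big_split/=.
      by apply: eq_bigr => y _; rewrite mE /a; ring.
    have := l0min m Lm; rewrite SE lerDl pmulr_rge0//.
  rewrite leNgt; apply/negP => B0.
  (* Letting [n] tend to infinity in [BC] removes the quadratic term. *)
  have : 0 <= 2 * B + 0 * C.
    apply: (@cvgr_to_ge nat \oo _ R (fun n => 2 * B + (1 / 2) ^+ n * C)); last by exists 0%N.
    apply: cvgD; first exact: cvg_cst.
    apply: cvgM; last exact: cvg_cst.
    by apply: cvg_expr; rewrite ger0_norm; lra.
  lra.
have gE : g (\sum_(y <- s) - a y *: y) = \sum_(y <- s) - a y * g y.
  pose G := GRing.isLinear.Build R X R^o *:%R g gl.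
  pose F : {linear X -> R^o} := HB.pack (g : X -> R^o) G.
  rewrite -[g]/(F : X -> R) linear_sum; apply: eq_bigr => y _.
  exact: linearZ.
(* By [var], [l0] maximises this test vector over [L], so its value there is an admissible bound for
   [g]. *)
have gs : g (\sum_(y <- s) - a y *: y) <= \sum_(y <- s) - a y * ev l0 y.
  apply: gL => l Ll; rewrite ev_sum -subr_ge0 -sumrB.
  apply: le_trans (var l Ll) _; rewrite le_eqVlt; apply/orP; left; apply/eqP.
  by apply: eq_bigr => y _; ring.
have a20 : \sum_(y <- s) a y ^+ 2 <= 0.
  move: gs; rewrite gE -subr_ge0 -sumrB -oppr_ge0; congr (0 <= _).
  by rewrite -sumrN; apply: eq_bigr => y _; rewrite /a; ring.
apply/allP => y ys; rewrite (_ : ev l0 y - g y = 0) ?normr0//.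
apply/eqP; rewrite -sqrf_eq0.
have : \sum_(y <- s) a y ^+ 2 == 0 by rewrite eq_le a20 sumr_ge0// => z _; exact: sqr_ge0.
rewrite psumr_eq0 => [/allP/(_ y ys)//|z _]; exact: sqr_ge0.
Qed.
End Bipolar.

(** * Linear spans and lifting vectors modulo an annihilator *)

Lemma ev_eq_closure {R : realType} {X : normedModType R} (k l : dual_ball X) (E : set X) :
  (forall x, E x -> ev k x = ev l x) ->
  forall x, closure (lin_span E) x -> ev k x = ev l x.
Proof.
move=> kl x xE; apply/eqP; rewrite -subr_eq0 -normr_le0 leNgt; apply/negP => d0.
have d2 : 0 < `|ev k x - ev l x| / 2 by rewrite divr_gt0.
have [y [[n [a [v [vE ->]]]]]] := xE _ (nbhsx_ballx x _ d2).
set y' := \sum_i _; have ky : ev k y' = ev l y'.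
  rewrite /y'; elim/big_ind : _ => [|u v' Hu Hv|i _]; first by rewrite !ev0.
    by rewrite !evD Hu Hv.
  by rewrite !evZ kl.
rewrite -ball_normE /ball_/= => xy.
have := ev_le k (x - y'); have := ev_le l (x - y'); rewrite !evD !evN ky.
have := ler_distD (ev l y') (ev k x) (ev l x); rewrite (distrC (ev l y')); lra.
Qed.

Section LinSpan.
Context {R : realType} {X : normedModType R}.
Implicit Types (A : set X) (x y : X).

Lemma sub_lin_span A : A `<=` lin_span A.
Proof.
move=> x Ax; exists 1%N, (fun=> 1), (fun=> x); split=> //.
by rewrite big_ord1 scale1r.
Qed.

Lemma lin_span0 A : lin_span A 0.
Proof. by exists 0%N, (fun=> 0), (fun=> 0); split=> [[]//|]; rewrite big_ord0. Qed.

Lemma lin_spanZ A a x : lin_span A x -> lin_span A (a *: x).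
Proof.
move=> [n [b [v [vA ->]]]]; exists n, (fun i => a * b i), v; split=> //.
by rewrite scaler_sumr; apply: eq_bigr => i _; rewrite scalerA.
Qed.

Lemma lin_spanD A x y : lin_span A x -> lin_span A y -> lin_span A (x + y).
Proof.
move=> [n [a [v [vA ->]]]] [m [b [w [wA ->]]]].
exists (n + m)%N, (fun i => match fintype.split i with inl j => a j | inr j => b j end),
  (fun i => match fintype.split i with inl j => v j | inr j => w j end); split.
  by move=> i; case: (fintype.split i).
rewrite big_split_ord/=; congr (_ + _); apply: eq_bigr => i _.
  by rewrite (unsplitK (inl i)).
by rewrite (unsplitK (inr i)).
Qed.

End LinSpan.

(** The seminorm [q], the supremum over [L], dominates the norm on the span of [E], so span vectors
    that approach [x] in [q] converge in norm. They exist because [p], the [q]-distance to the span,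
    vanishes at [x]. *)
Lemma lift_modulo_annihilator {R : realType} {X : completeNormedModType R}
    (L : set (dual_ball X)) (E : set X) :
  compact L -> L !=set0 -> midpoint_closed L ->
  (forall k, L k -> exists2 m, L m & forall x, ev m x = - ev k x) ->
  (forall k : dual_ball X, exists2 l, L l & forall x, E x -> ev l x = ev k x) ->
  (forall k l, L k -> L l -> (forall x, E x -> ev k x = ev l x) -> k = l) ->
  forall x, exists2 e, closure (lin_span E) e & forall l, L l -> ev l x = ev l e.
Proof.
move=> Lc [l0 Ll0] Lmid Lopp Lext Lsep x.
pose Q y := [set ev l y | l in L].
pose q y := sup (Q y).
have Qsup y : has_sup (Q y).
  split; first by exists (ev l0 y), l0.
  by exists `|y| => _ [l _ <-]; rewrite (le_trans (ler_norm _))// ev_le.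
have ev_q l y : L l -> ev l y <= q y.
  by move=> Ll; apply: ub_le_sup; [exact: (Qsup y).2|exists l].
have q_le y M : (forall l, L l -> ev l y <= M) -> q y <= M.
  by move=> LM; apply: ge_sup; [exact: (Qsup y).1|move=> _ [l Ll <-]; exact: LM].
have q0 y : 0 <= q y.
  have [m Lm mE] := Lopp _ Ll0.
  have := ev_q _ y Ll0; have := ev_q _ y Lm; rewrite mE; lra.
have qD y z : q (y + z) <= q y + q z.
  by apply: q_le => l Ll; rewrite evD lerD// ev_q.
have qZ t y : 0 <= t -> q (t *: y) <= t * q y.
  by move=> t0; apply: q_le => l Ll; rewrite evZ ler_wpM2l// ev_q.
have qN y : q (- y) <= q y.
  apply: q_le => l Ll; have [m Lm mE] := Lopp _ Ll.
  by rewrite evN -mE ev_q.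
(* A norming functional for [e] agrees on [E], hence at [e], with a member of [L]. *)
have q_norm e : lin_span E e -> `|e| <= q e.
  move=> Ee; have [|g [gl gle ge]] := @hahn_banach R X (fun y => `|y|) e.
    by split=> [y z|t y t0]; [exact: ler_normD|rewrite normrZ ger0_norm].
  have [k kg] := dual_ball_of g gl gle.
  have [l Ll lk] := Lext k; rewrite -ge -kg.
  by rewrite -(ev_eq_closure _ _ _ lk) ?ev_q//; exact: subset_closure.
pose P y := [set q (y - e) | e in lin_span E].
pose p y := inf (P y).
have P0 y : P y !=set0 by exists (q (y - 0)), 0 => //; exact: lin_span0.
have p_le y e : lin_span E e -> p y <= q (y - e).
  by move=> Ee; apply: ge_inf; [exists 0 => _ [z _ <-]|exists e].
have sp : sublinear p.
  split=> [y z|t y].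
    rewrite -lerBlDr; apply: lb_le_inf => // _ [e Ee <-].
    rewrite lerBlDr -lerBlDl; apply: lb_le_inf => // _ [e' Ee' <-].
    rewrite lerBlDl (le_trans (p_le _ _ (lin_spanD _ _ _ Ee Ee')))//.
    by rewrite opprD addrACA.
  rewrite le_eqVlt => /predU1P[<-|t0].
    rewrite scale0r mul0r (le_trans (p_le _ _ (lin_span0 _)))// subr0.
    by apply: q_le => l _; rewrite ev0.
  rewrite -ler_pdivrMl//; apply: lb_le_inf => // _ [e Ee <-].
  rewrite ler_pdivrMl// (le_trans (p_le _ _ (lin_spanZ _ t _ Ee)))//.
  by rewrite -scalerBr qZ// ltW.
have px : p x = 0.
  have [g [gl gp <-]] := hahn_banach p x sp.
  have gq y M : (forall l, L l -> ev l y <= M) -> g y <= M.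
    move=> LM; rewrite (le_trans (gp y))// (le_trans (p_le _ _ (lin_span0 _)))//.
    by rewrite subr0 q_le.
  have [l Ll lg] := compact_midpoint_bipolar L g Lc (ex_intro _ l0 Ll0) Lmid gl gq.
  have [m Lm mE] := Lopp _ Ll.
  have lE e : lin_span E e -> ev l e <= 0.
    move=> Ee; rewrite lg (le_trans (gp e))// (le_trans (p_le _ _ Ee))//.
    by apply: q_le => k _; rewrite subrr ev0.
  (* Being at most 0 on a subspace, [l] vanishes there, so it agrees on [E] with its opposite [m];
     separation gives [l = m], hence [l = 0]. *)
  have lm : l = m.
    apply: Lsep => // e Ee; rewrite mE.
    have := lE _ (sub_lin_span _ _ Ee).
    have := lE _ (lin_spanZ _ (-1) _ (sub_lin_span _ _ Ee)).
    by rewrite evZ; lra.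
  by have := mE x; rewrite -lm -lg; lra.
have /choice[u uP] n : exists e, lin_span E e /\ q (x - e) < n.+1%:R^-1.
  have n0 : 0 < n.+1%:R^-1 :> R by rewrite invr_gt0.
  have [|_ [e Ee <-]] := @inf_adherent R (P x) _ n0.
    by split=> //; exists 0 => _ [z _ <-].
  by rewrite -/(p x) px add0r => qe; exists e.
have un e : 0 < e -> \forall n \near \oo, q (x - u n) < e.
  move=> e0; near=> n; apply: (lt_trans (uP n).2); near: n.
  exact: near_infty_natSinv_lt (PosNum e0).
(* The differences lie in the span, where [q] controls the norm, so [u] is Cauchy. *)
have uu n m : `|u n - u m| <= q (x - u n) + q (x - u m).
  have Eu : lin_span E (u n - u m).
    by apply: lin_spanD; [|rewrite -scaleN1r; apply: lin_spanZ]; exact: (uP _).1.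
  rewrite (le_trans (q_norm _ Eu))//.
  have := qD (u n - x) (x - u m); rewrite addrA subrK.
  by move=> /le_trans; apply; rewrite lerD2r -opprB qN.
have ucvg : cvg (u n @[n --> \oo]).
  apply: cauchy_cvg; apply: cauchy_exP => e e0.
  have e2 : 0 < e / 2 by rewrite divr_gt0.
  have [N _ Nu] := un _ e2; exists (u N); exists N => // n /= Nn.
  rewrite -ball_normE /ball_/= (le_lt_trans (uu _ _))// [e]splitr ltrD//; apply: Nu => //=.
exists (lim (u n @[n --> \oo])).
  apply: (closed_cvg _ (@closed_closure _ (lin_span E)) _ _ ucvg).
  by apply: nearW => n; apply: subset_closure; exact: (uP n).1.
move=> l Ll; set e := lim _; apply/eqP; rewrite -subr_eq0 -normr_le0.
apply/ler_addgt0Pl => d d0; rewrite addr0.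
have d2 : 0 < d / 2 by rewrite divr_gt0.
have ue : \forall n \near \oo, `|e - u n| < d / 2 by move/cvgrPdist_lt : ucvg; apply.
near \oo => n.
have : `|e - u n| < d / 2 by near: n.
have : q (x - u n) < d / 2 by near: n; exact: un.
have := ev_le l (e - u n).
have := ev_q _ (x - u n) Ll; have := le_trans (ev_q _ (- (x - u n)) Ll) (qN _).
rewrite !evN !evD !evN => H1 H2 H3 H4 H5.
rewrite ler_norml; move: H3; rewrite ler_norml; lra.
Unshelve. all: by end_near. Qed.

(** * Corson compact dual balls: closing off and the generating family *)

Lemma countable_coordinate_dense {R : realType} {T I : Type} (t0 : T)
    (psi : I -> T -> R) (s : seq I) :
  exists2 D : set T, countable D &
    forall t e, 0 < e -> exists2 d, D d & all (fun i => `|psi i d - psi i t| < e) s.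
Proof.
(* Here [p] codes a box with rational centre [p.1] and radius [1 / (p.2 + 1)]. Picking one point
   from each nonempty box, and [t0] for empty ones, gives the countable set. *)
pose near_pt (p : seq rat * nat) t :=
  all (fun iq => `|psi iq.1 t - ratr iq.2| < p.2.+1%:R^-1) (zip s p.1).
have /choice[g gP] p : exists t, forall u, near_pt p u -> near_pt p t.
  have [[u pu]|np] := pselect (exists u, near_pt p u); first by exists u.
  by exists t0 => u pu; case: np; exists u.
exists (range g); first exact: sub_countable (card_image_le _ _) _.
move=> t e e0.
have [n ne] : exists n, n.+1%:R^-1 < e / 2.
  have e2 : 0 < e / 2 by rewrite divr_gt0.
  have [n] := ltr_add_invr e2; rewrite add0r => ne; by exists n.
have n0 : 0 < n.+1%:R^-1 :> R by rewrite invr_gt0.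
have /choice[r rP] i : exists q : rat, `|psi i t - ratr q| < n.+1%:R^-1.
  have a_e : psi i t - n.+1%:R^-1 < psi i t by rewrite ltrBlDr ltrDl.
  have [q] := rat_in_itvoo a_e; rewrite in_itv/= => /andP[qa aq]; exists q.
  by rewrite ltr_norml; move: n0 qa aq; move: (n.+1%:R^-1) => d *; lra.
pose p := (map r s, n).
have zE : zip s (map r s) = map (fun i => (i, r i)) s.
  by elim: (s) => //= i s' ->.
have : near_pt p (g p).
  by apply: (gP p t); rewrite /near_pt/= zE all_map; elim: (s) => //= i s' ->; rewrite rP.
rewrite /near_pt {1}/p/= zE all_map => gp; exists (g p); first by exists p.
apply: sub_all gp => i /= gi; move: (rP i).
move: ne gi; move: (n.+1%:R^-1) => d.
have := ler_distD (ratr (r i)) (psi i (g p)) (psi i t); rewrite (distrC (ratr _)).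
lra.
Qed.

Section Corson.
Context {R : realType} {X : completeNormedModType R}.
Implicit Types (k l : dual_ball X) (x : X).

Lemma dual_ball_opp k : exists m : dual_ball X, forall x, ev m x = - ev k x.
Proof.
have [a x y|x|m mE] := @dual_ball_of R X (fun x => - ev k x).
- by rewrite ev_linear /GRing.scale/=; ring.
- by rewrite (le_trans (ler_norm _))// normrN ev_le.
by exists m => x; rewrite mE.
Qed.

Lemma dual_ball_mid k l :
  exists m : dual_ball X, forall x, ev m x = (ev k x + ev l x) / 2.
Proof.
have [a x y|x|m mE] := @dual_ball_of R X (fun x => (ev k x + ev l x) / 2).
- by rewrite !ev_linear /GRing.scale/=; ring.
- have := le_trans (ler_norm _) (ev_le k x); have := le_trans (ler_norm _) (ev_le l x); lra.
by exists m => x; rewrite mE.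
Qed.

(** The requirements on [A], [E] and [D] refer to one another, so all three are built at once as the
    slices of one closed-off set in the disjoint union [U]. Both directions of determination between
    coordinates and evaluations come from [countably_determined]. *)
Lemma Corson_closing_off (Gamma : Type) (c : Gamma -> dual_ball X -> R)
    (opp : dual_ball X -> dual_ball X) (mid : dual_ball X -> dual_ball X -> dual_ball X)
    (D0 : set (dual_ball X)) :
  compact [set: dual_ball X] -> (forall gamma, continuous (c gamma)) ->
  (forall k l, (forall gamma, c gamma k = c gamma l) -> k = l) ->
  (forall k, countable [set gamma | c gamma k != 0]) -> countable D0 ->
  exists (A : set Gamma) (E : set X) (D : set (dual_ball X)),
  [/\ [/\ countable E, D0 `<=` D, forall k, D k -> D (opp k) &
         forall k l, D k -> D l -> D (mid k l)],
      forall d gamma, D d -> c gamma d != 0 -> A gamma,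
      forall gamma k l, A gamma -> (forall x, E x -> ev k x = ev l x) -> c gamma k = c gamma l,
      forall x k l, E x -> (forall gamma, A gamma -> c gamma k = c gamma l) -> ev k x = ev l x &
      forall (s : seq Gamma) k e, all (fun gamma => `[< A gamma >]) s -> 0 < e ->
        exists2 d, D d & all (fun gamma => `|c gamma d - c gamma k| < e) s].
Proof.
move=> Kc cc csep csupp D0c.
have [k0 _] : exists k0 : dual_ball X, True.
  have [a x y|x|k _] := @dual_ball_of R X (fun=> 0); last by exists k.
    by rewrite scaler0 addr0.
  by [].
have [Ex Exc ExP] := all_sig2 (fun gamma => cid2 (countably_determined X (c gamma)
  (fun x k => ev k x) Kc (cc gamma) ev_weak_continuous ev_inj)).
have [Ax Axc AxP] := all_sig2 (fun x => cid2 (countably_determined Gamma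
  (fun k => ev k x) c Kc (ev_weak_continuous x) cc csep)).
have [Ds Dsc DsP] := all_sig2 (fun s => cid2 (countable_coordinate_dense k0 c s)).
pose U := (Gamma + X + dual_ball X)%type.
pose coord (u : U) : option Gamma := if u is inl (inl gamma) then Some gamma else None.
(* The shape of [s] selects the operation. The dense set [Ds] is added for every [s], using
   whichever coordinates occur in it. *)
pose Phi (s : seq U) : set U := inr @` Ds (pmap coord s) `|`
  match s with
  | [:: inl (inl gamma)] => (inl \o inr) @` Ex gamma
  | [:: inl (inr x)] => (inl \o inl) @` Ax x
  | [:: inr k] => inr (opp k) |` ((inl \o inl) @` [set gamma | c gamma k != 0])
  | [:: inr k; inr l] => [set inr (mid k l)]
  | _ => set0
  end.
have Phic s : countable (Phi s).
  have img (V W : Type) (f : V -> W) (B : set V) : countable B -> countable (f @` B).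
    exact: sub_countable (card_image_le _ _).
  have cU (B C : set U) : countable B -> countable C -> countable (B `|` C).
    by move=> Bc Cc; rewrite -bigcup2E; apply: bigcup_countable => // -[|[|]].
  apply: (cU); first exact: img.
  case: s => [|[[gamma|x]|k] [|[[gamma'|x']|l] [|u s]]] //=; try exact: img.
  by apply: (cU) => //; exact: img.
have [S [Sc D0S Scl]] :=
  countable_closing_off (inr k0) Phi (inr @` D0) (sub_countable (card_image_le _ _) D0c) Phic.
have pre (V : Type) (f : V -> U) : injective f -> countable (f @^-1` S).
  move=> finj; have /countable_injP[g ginj] := Sc.
  apply/countable_injP; exists (g \o f) => v w.
  by rewrite !inE => Sv Sw /ginj => /(_ (mem_set Sv) (mem_set Sw)) /finj.
exists [set gamma | S (inl (inl gamma))], [set x | S (inl (inr x))], [set k | S (inr k)].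
split; first split.
- by apply: pre => x y [].
- by move=> k Dk; apply: D0S; exists k.
- by move=> k Sk; apply: (Scl [:: inr k]); [rewrite /= asboolT|right; left].
- by move=> k l Sk Sl; apply: (Scl [:: inr k; inr l]); [rewrite /= !asboolT|right].
- move=> d gamma Sd dg; apply: (Scl [:: inr d]); first by rewrite /= asboolT.
  by right; right; exists gamma.
- move=> gamma k l Sg kl; apply: ExP => x Ex_x; apply: kl.
  by apply: (Scl [:: inl (inl gamma)]); [rewrite /= asboolT|right; exists x].
- move=> x k l Sx kl; apply: AxP => gamma Ax_g; apply: kl.
  by apply: (Scl [:: inl (inr x)]); [rewrite /= asboolT|right; exists gamma].
- move=> s k e sA e0; have [d Dd ds] := DsP s k e e0; exists d => //.
  apply: (Scl (map (inl \o inl) s)); first by rewrite all_map.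
  by left; exists d => //; rewrite (map_pK (f := coord)).
Qed.

Theorem WLD_generating : WLD X -> forall f : nat -> dual X,
  exists (Gamma : Type) (x : Gamma -> X),
    generating x /\ forall n, countable [set gamma | \val (f n) (x gamma) != 0].
Proof.
move=> [Kc _ [Gamma [h [hinj hc _]]]] f.
pose c gamma k : R := \val (h k) gamma.
have cc gamma : continuous (c gamma).
  move=> k; apply: (@continuous_comp _ _ _ h (fun g => \val g gamma)); first exact: hc.
  apply: (@continuous_comp _ _ _ (fun g : @Sigma_product R Gamma => \val g)
    (fun g : {ptws Gamma -> R} => g gamma)); first exact: initial_continuous.
  exact: (@proj_continuous {classic Gamma} (fun=> R) gamma).
have csep k l : (forall gamma, c gamma k = c gamma l) -> k = l.
  by move=> kl; apply/hinj/val_inj/funext.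
have csupp k : countable [set gamma | c gamma k != 0] by exact: set_mem (valP (h k)).
have /choice[opp oppE] := @dual_ball_opp.
have /choice[mid' midE'] (kl : dual_ball X * dual_ball X) := dual_ball_mid kl.1 kl.2.
pose mid k l := mid' (k, l).
have midE k l x : ev (mid k l) x = (ev k x + ev l x) / 2 by exact: midE'.
(* A rescaling of [f n] into the ball; it is enough to remember that its kernel lies in that of
   [f n]. *)
have /choice[fb fbP] n : exists k : dual_ball X,
    forall x, \val (f n) x != 0 -> ev k x != 0.
  have [a a0 [k kE]] := dual_ball_scale (f n).
  by exists k => x fx; rewrite kE mulf_neq0// gt_eqF.
have [|A [E [D [[Ec D0D Dopp Dmid] DA AE EA Dapp]]]] :=
    Corson_closing_off Gamma c opp mid (range fb) Kc cc csep csupp.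
  exact: sub_countable (card_image_le _ _) _.
pose L := closure D.
have DL : D `<=` L by exact: subset_closure.
have Lc : compact L.
  by apply: (subclosed_compact _ Kc) => //; exact: closed_closure.
have closed_in (C : set (dual_ball X)) : closed C -> D `<=` C -> L `<=` C.
  by move=> Cc DC; rewrite ((closure_id C).1 Cc); exact: closure_subset.
have oppc : continuous opp.
  apply: dual_ball_continuous => x k.
  rewrite (_ : (fun t => ev (opp t) x) = (fun t => - ev t x)); last by apply/funext.
  exact: (continuousN (@ev_weak_continuous _ _ x k)).
have midc k : continuous (mid k).
  apply: dual_ball_continuous => x l.
  rewrite (_ : (fun t => _) = (fun t => (ev k x + ev t x) / 2)); last by apply/funext.
  have cD : {for l, continuous (fun t => ev k x + ev t x : R)}.
    exact: (continuousD (@cst_continuous _ _ (ev k x) l) (@ev_weak_continuous _ _ x l)).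
  exact: (continuousM cD (@cst_continuous _ _ (2^-1 : R) l)).
have midC k l : mid k l = mid l k by apply: ev_inj => x; rewrite !midE addrC.
have closedL (g : dual_ball X -> dual_ball X) : continuous g -> closed (g @^-1` L).
  by move=> gc; apply: preimage_closed; [move=> ? _; exact: gc|exact: closed_closure].
have Lopp k : L k -> L (opp k).
  apply: (closed_in (opp @^-1` L) (closedL _ oppc)).
  by move=> {}k Dk; exact/DL/Dopp.
(* Pass to the closure in one variable at a time, swapping the arguments by [midC]; separate
   continuity suffices. *)
have Lmid k l : L k -> L l -> L (mid k l).
  move=> Lk; apply: (closed_in (mid k @^-1` L) (closedL _ (midc k))) => {}l Dl /=.
  rewrite midC; move: k Lk; apply: (closed_in (mid l @^-1` L) (closedL _ (midc l))).
  by move=> k Dk /=; rewrite midC; exact/DL/Dmid.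
have LA l gamma : L l -> ~ A gamma -> c gamma l = 0.
  move=> Ll nA.
  have cl : closed (c gamma @^-1` [set 0]).
    by apply: preimage_closed; [move=> ? _; exact: cc|exact: closed_eq].
  apply: (closed_in _ cl) _ Ll => d Dd /=.
  by apply: contra_notP nA => /eqP; exact: DA.
have Lsep k l : L k -> L l -> (forall x, E x -> ev k x = ev l x) -> k = l.
  move=> Lk Ll kl; apply: csep => gamma.
  have [Ag|nAg] := pselect (A gamma); first exact: AE kl.
  by rewrite !LA.
(* Compactness of [L] turns approximation by [D] on finitely many coordinates into agreement on all
   of [A], which determines the evaluations on [E]. *)
have Lext k : exists2 l, L l & forall x, E x -> ev l x = ev k x.
  have [[gamma Ag]|s e e0|l Ll lk] := @compact_interpolation _ _ {gamma | A gamma} L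
    (fun i => c (sval i)) (fun i => c (sval i) k) Lc.
  - exact: cc.
  - have [|d Dd ds] := Dapp (map sval s) k e _ e0.
      by rewrite all_map; elim: (s) => //= -[gamma Ag] s' ->; rewrite asboolT.
    by exists d; [exact: DL|move: ds; rewrite all_map].
  - exists l => // x Ex; apply: EA Ex _ => gamma Ag.
    exact: lk (exist _ gamma Ag).
have L0 : L !=set0 by exists (fb 0%N); apply/DL/D0D; exists 0%N.
have lift := lift_modulo_annihilator L E Lc L0
  (fun k l Lk Ll => ex_intro2 _ _ (mid k l) (Lmid k l Lk Ll) (midE k l))
  (fun k Lk => ex_intro2 _ _ (opp k) (Lopp k Lk) (oppE k)) Lext Lsep.
(* The family is this set indexed by itself. A member on which some [f n] is nonzero must lie in the
   countable set [E]. *)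
pose B := [set x | E x \/ forall n, \val (f n) x = 0].
exists {x | B x}, sval; split.
  apply/seteqP; split=> // x _; have [e Ee xe] := lift x.
  have Bxe : B (x - e).
    right=> n; have : ev (fb n) (x - e) = 0.
      by rewrite evD evN xe ?subrr//; apply/DL/D0D; exists n.
    by apply: contra_eq; exact: fbP.
  move=> U /nbhs_ballP[r /= r0 rU].
  have [w [wE ew]] := Ee _ (nbhsx_ballx e _ r0).
  (* Here [w] is in the span of [E] and close to [e], while [x - e] is in the common kernel. *)
  exists (w + (x - e)); split.
    apply: lin_spanD; last by apply: sub_lin_span; exists (exist _ _ Bxe).
    move: wE => [m [a [v [vE ->]]]]; exists m, a, v; split=> // i.
    by exists (exist B (v i) (or_introl (vE i))).
  apply: rU; move: ew; rewrite -ball_normE /ball_/=.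
  by rewrite opprD opprB addrCA [e - x]addrC addNKr addrC.
have /countable_injP[g ginj] := Ec.
move=> n; apply/countable_injP; exists (g \o sval) => -[y By] [z Bz].
rewrite !inE/= => /eqP fy /eqP fz /ginj.
have EB t : B t -> \val (f n) t <> 0 -> t \in E by move=> [Et|/(_ n)//] _; exact: mem_set.
by move=> /(_ (EB _ By fy) (EB _ Bz fz)) yz; exact: eq_exist.
Qed.
End Corson.

(** * Countable intersections of coseparable subspaces *)

Theorem theorem4p2 (R : realType) (X : completeNormedModType R)
    (Xinf : infinite_dimensional X) :
  ((forall f : nat -> dual X,
      exists (Gamma : Type) (x : Gamma -> X),
        generating x /\
        forall n, countable [set gamma | \val (f n) (x gamma) != 0]) ->
   forall Y : nat -> closed_subspace X,
     (forall n, coseparable (Y n)) -> coseparable (bigcap_subspace Y)) /\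
  (WLD X ->
   forall Y : nat -> closed_subspace X,
     (forall n, coseparable (Y n)) -> coseparable (bigcap_subspace Y)).
Proof.
suff main : (forall f : nat -> dual X,
      exists (Gamma : Type) (x : Gamma -> X),
        generating x /\
        forall n, countable [set gamma | \val (f n) (x gamma) != 0]) ->
    forall Y : nat -> closed_subspace X,
      (forall n, coseparable (Y n)) -> coseparable (bigcap_subspace Y).
  by split=> // /WLD_generating.
move=> gen Y Ysep.
have /choice[f fP] n := coseparable_annihilator (Y n) (Ysep n).
(* An enumeration of pairs merges the functionals [f n k] into one sequence. *)
have [pair pairP] := countable_range_of (0%N, 0%N) (countableP [set: nat * nat]).
have [Gamma [x [xgen xf]]] := gen (fun m => f (pair m).1 (pair m).2).
apply: (generating_coseparable Gamma x) => //.
(* The union of the supports is countable, and a family vector outside it is annihilated by every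
   [f n k], so it lies in every [Y n]. *)
have := @bigcup_countable _ _ [set: nat] _ (countableP _) (fun m _ => xf m).
apply: sub_countable; apply: subset_card_le => gamma /= nZ.
apply: contrapT => nf; apply: nZ => n _; apply/fP => k.
have [m _ mE] := pairP (n, k) I.
apply/eqP; apply: contrapT => /negP fx; apply: nf; exists m => //=.
by rewrite mE.
Qed.
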